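(* Let $N$ be a unitarily invariant norm on $M_n(\mathbb{C})$, let $A\in M_n(\mathbb{C})$ be positive definite and let $X\in M_n(\mathbb{C})$. Then $$w_N(A^{t}XA^{1-t})\le t\,w_N(AX)+(1-t)\,w_N(XA)\quad\text{if } t\in[0,1],$$ $$w_N(A^{t}XA^{1-t})\ge t\,w_N(AX)+(1-t)\,w_N(XA)\quad\text{if } t\in\mathbb{R}\setminus[0,1].$$
   Context: For a norm $N$ on $M_n(\mathbb{C})$ (the $n\times n$ complex matrices), the generalized numerical radius of $Y\in M_n(\mathbb{C})$ is $w_N(Y)=\sup_{\theta\in\mathbb{R}}N(\mathrm{Re}(e^{i\theta}Y))$, where $\mathrm{Re}(Z)=\frac12(Z+Z^* )$. The norm $N$ is unitarily invariant if $N(UYV)=N(Y)$ for all $Y\in M_n(\mathbb{C})$ and all unitary $U,V\in M_n(\mathbb{C})$. For a positive definite (Hermitian) matrix $A$ and $t\in\mathbb{R}$, $A^t$ is defined by the functional calculus. *)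

(* Defs.v *)
From HB Require Import structures.
From mathcomp Require Export all_boot all_order all_algebra.
From mathcomp Require Export sesquilinear spectral.
From mathcomp Require Export complex.
From mathcomp Require Export boolp classical_sets reals exp trigo.

Set Implicit Arguments.
Unset Strict Implicit.
Unset Printing Implicit Defensive.

Import Order.TTheory GRing.Theory Num.Theory.
Local Open Scope ring_scope.
Local Open Scope classical_set_scope.
Local Open Scope complex_scope.
Local Open Scope sesquilinear_scope.

Section MatrixNorms.
Variables (R : realType) (n : nat).
Implicit Types (A Y Z : 'M[R[i]]_n) (N : 'M[R[i]]_n -> R) (t : R).

(* [normc] is the modulus with values in R; [`|c|] would be valued in R[i]. *)
Record is_mxnorm N : Prop := IsMxNorm {
  mxnorm_ge0 : forall Y, 0 <= N Y;
  mxnorm_eq0 : forall Y, N Y = 0 -> Y = 0;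
  mxnormZ : forall (c : R[i]) Y, N (c *: Y) = ComplexField.Normc.normc c * N Y;
  ler_mxnormD : forall Y Z, N (Y + Z) <= N Y + N Z }.

Definition unitarily_invariant N : Prop :=
  forall Y U V, U \is unitarymx -> V \is unitarymx -> N (U *m Y *m V) = N Y.

Definition mxRe Z : 'M[R[i]]_n := 2^-1 *: (Z + Z ^t*).

Definition expi (theta : R) : R[i] := cos theta +i* sin theta.

(* The supremum is over a nonempty set, bounded by (N Y + N (Y ^t* )) / 2 when
   N is a norm, so [sup] does not take its default value. *)
Definition num_radius N Y : R :=
  sup [set N (mxRe (expi theta *: Y)) | theta in [set: R]].

(* The order on R[i] is partial: 0 < z means that z is real and positive. *)
Definition posdefmx A : Prop :=
  A \is hermsymmx /\
  forall x : 'cV[R[i]]_n, x != 0 -> 0 < (x ^t* *m A *m x) 0 0.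

(* Functional calculus f(A) for Hermitian A, through the unitary
   diagonalization A = P^-1 *m diag_mx d *m P with P := spectralmx A and
   d := spectral_diag A; the entries of d are then real. *)
Definition herm_calc (f : R -> R) A : 'M[R[i]]_n :=
  invmx (spectralmx A)
  *m diag_mx (map_mx (fun z : R[i] => (f (complex.Re z))%:C) (spectral_diag A))
  *m spectralmx A.

Definition mxpowR A t : 'M[R[i]]_n := herm_calc (fun x => x `^ t) A.

End MatrixNorms.

(* Main.v *)
Require Import Defs.
From mathcomp Require Import topology normedtype derive sequences.
From mathcomp Require Import ring lra.

(** Both inequalities follow once f(t) = w_N(A^t X A^(1-t)) is convex on the real
    line.  By unitary invariance A may be taken diagonal, A = diag(exp(l_i)).
    Fix theta, put H = Re(e^(i theta) A^t X A^(1-t)) and let K be the mean of the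
    corresponding matrices at t + h and t - h.  Then
    K_ij = cosh(h (l_i - l_j)) H_ij, while the matrix
    cos(h (l_i - l_j)) K_ij is the mean of the two unitary conjugates
    A^(ih) K A^(-ih) and A^(-ih) K A^(ih), so its norm is at most N(K).  As
    cos y cosh y = 1 + o(y^2), this gives
    2 f(t) <= f(t + h) + f(t - h) + o(h^2), and a continuous function with this
    property is convex: otherwise f minus a chord plus a small convex parabola
    would have an interior maximum. *)

Set Implicit Arguments.
Unset Strict Implicit.
Unset Printing Implicit Defensive.

Import Order.TTheory GRing.Theory Num.Theory.
Import numFieldNormedType.Exports.
Import ComplexField.Normc.
Local Open Scope ring_scope.
Local Open Scope classical_set_scope.
Local Open Scope complex_scope.
Local Open Scope sesquilinear_scope.

(** * Limits at zero, up to the second-order behaviour of cos y cosh y *)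

Lemma is_derive_cvg_slope0 (R : realType) (f : R -> R) (d : R) :
  is_derive (0 : R) 1 f d -> f 0 = 0 -> f h / h @[h --> (0:R)^'] --> d.
Proof.
move=> [df fd] f0.
have /cvg_ex[l hl] := df.
have <- : l = d by rewrite -fd; apply/esym/cvg_lim.
apply: cvg_trans hl; apply: near_eq_cvg; near=> h.
by rewrite /= f0 subr0 addr0 mulrC [h *: 1]mulr1.
Unshelve. all: by end_near. Qed.

Lemma cvg_sumr (R : realType) (T : Type) (I : finType) (F : set_system T)
    (f : I -> T -> R) (a : I -> R) : Filter F ->
  (forall i, f i x @[x --> F] --> a i) ->
  \sum_i f i x @[x --> F] --> \sum_i a i.
Proof. by move=> FF fa; apply: cvg_big => //; exact: add_continuous. Qed.

(** With s = sin(hx/2) and e = sinh(hx/2), cos(hx) = 1 - 2s^2 and cosh(hx) = 1 + 2e^2, so the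
    numerator is 2(e^2 - s^2) - 4 s^2 e^2. Both s/h and e/h tend to x/2, which cancels the first
    term; s -> 0 removes the second. *)
Lemma cvg_cos_cosh (R : realType) (x : R) :
  (cos (h * x) * ((expR (h * x) + expR (- (h * x))) / 2) - 1) / h ^+ 2
    @[h --> (0:R)^'] --> (0 : R).
Proof.
pose s (h : R) := sin (h * (x / 2)).
pose e (h : R) := (expR (h * (x / 2)) - expR (- (h * (x / 2)))) / 2.
have cvs : s h / h @[h --> (0:R)^'] --> x / 2.
  apply: is_derive_cvg_slope0; last by rewrite /s mul0r sin0.
  rewrite /s; apply: is_derive_eq.
  by rewrite /GRing.scale /= mul0r cos0; ring.
have cve : e h / h @[h --> (0:R)^'] --> x / 2.
  apply: is_derive_cvg_slope0; last by rewrite /e mul0r oppr0 subrr mul0r.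
  rewrite /e; apply: is_derive_eq.
  by rewrite /GRing.scale /= mul0r oppr0 expR0; field.
have cvs0 : s h @[h --> (0:R)^'] --> (0 : R).
  have ch : h @[h --> (0:R)^'] --> (0 : R) by move=> U; exact: nbhs_dnbhs.
  have : s h / h * h @[h --> (0:R)^'] --> x / 2 * 0 by exact: cvgM.
  rewrite mulr0; apply: cvg_trans; apply: near_eq_cvg; near=> h.
  rewrite /= divfK //; near: h; exact: nbhs_dnbhs_neq.
have : 2 * ((e h / h) * (e h / h) - (s h / h) * (s h / h)) -
    4 * (s h * s h * ((e h / h) * (e h / h))) @[h --> (0:R)^'] -->
    2 * ((x / 2) * (x / 2) - (x / 2) * (x / 2)) -
    4 * (0 * 0 * ((x / 2) * (x / 2))).
  apply: cvgB; apply: cvgM; first exact: cvg_cst.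
  - by apply: cvgB; apply: cvgM.
  - exact: cvg_cst.
  - by apply: cvgM; apply: cvgM.
rewrite !(mul0r, mulr0, subrr); apply: cvg_trans; apply: near_eq_cvg; near=> h.
have h0 : h != 0 by near: h; exact: nbhs_dnbhs_neq.
have hx : h * x = (h * (x / 2)) *+ 2 by rewrite -mulr_natr; field.
rewrite [in RHS]hx cos_mulr2n cos2sin2 expRN [(h * _) *+ 2]mulr2n expRD /=.
rewrite -/(s h) /e expRN.
move: (expR_gt0 (h * (x / 2))).
move: (expR _) (s h) => E S E0.
field.
by rewrite h0 gt_eqF.
Unshelve. all: by end_near. Qed.

(** * Convexity from an approximate midpoint inequality *)

Definition chord_convex (R : realType) (f : R -> R) : Prop :=
  forall a b p, a < b -> a <= p <= b ->
    (b - a) * f p <= (b - p) * f a + (p - a) * f b.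

Lemma approx_midpoint_convex (R : realType) (f : R -> R) :
  continuous f ->
  (forall t e d : R, 0 < e -> 0 < d ->
     exists2 h, 0 < h < d & 2 * f t <= f (t + h) + f (t - h) + e * h ^+ 2) ->
  chord_convex f.
Proof.
move=> cf mf a b p ab /andP[ap pb]; rewrite leNgt; apply/negP => fp.
pose g t := (b - a) * f t - (b - t) * f a - (t - a) * f b.
have gp : 0 < g p by rewrite /g; lra.
have ba : 0 < b - a by rewrite subr_gt0.
(* Any q > (p - a)(b - p) makes the parabola smaller than g at p, so that G p > 0; adding 1 keeps q
   positive when p is an endpoint. *)
pose q := (p - a) * (b - p) + 1.
have q0 : 0 < q by rewrite /q; nra.
pose e := g p / q.
have e0 : 0 < e by rewrite divr_gt0.
pose G t := g t - e * ((t - a) * (b - t)).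
have Gp : 0 < G p.
  have : e * q = g p by rewrite /e divfK ?gt_eqF.
  by rewrite /G /q; lra.
have cG : continuous G.
  move=> t; rewrite /G /g.
  have ct := @cvg_id _ (nbhs t).
  apply: cvgB; last by
    apply: cvgM; [exact: cvg_cst|apply: cvgM; apply: cvgB => //; exact: cvg_cst].
  apply: cvgB; last by apply: cvgM; [apply: cvgB => //; exact: cvg_cst|exact: cvg_cst].
  apply: cvgB; last by apply: cvgM; [apply: cvgB => //; exact: cvg_cst|exact: cvg_cst].
  by apply: cvgM; [exact: cvg_cst|exact: cf].
have [c cab cM] := EVT_max (ltW ab) (continuous_subspaceT cG).
have Gc : 0 < G c by apply: lt_le_trans Gp (cM _ _); rewrite in_itv /= ap pb.
move: cab; rewrite in_itv /= => /andP[ac cb].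
have Ga : G a = 0 by rewrite /G /g; ring.
have Gb : G b = 0 by rewrite /G /g; ring.
have {}ac : a < c.
  by rewrite lt_neqAle ac andbT; apply: contraTneq Gc => <-; rewrite Ga ltxx.
have {}cb : c < b.
  by rewrite lt_neqAle cb andbT; apply: contraTneq Gc => ->; rewrite Gb ltxx.
have d0 : 0 < Num.min (c - a) (b - c) by rewrite lt_min !subr_gt0 ac cb.
(* The parabola adds 2 e h^2 to the second difference of G at c. The slack e / (b - a), scaled by b
   - a, costs only e h^2, so the second difference is positive, against the maximality of G c. *)
have [h /andP[h0 +] fh] := mf c (e / (b - a)) _ (divr_gt0 e0 ba) d0.
rewrite lt_min => /andP[h1 h2].
have Gl : G (c - h) <= G c by apply: cM; rewrite in_itv /=; apply/andP; split; lra.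
have Gr : G (c + h) <= G c by apply: cM; rewrite in_itv /=; apply/andP; split; lra.
have {}fh : (b - a) * (2 * f c) <= (b - a) * (f (c + h) + f (c - h)) + e * h ^+ 2.
  have := ler_wpM2l (ltW ba) fh; rewrite [in X in _ <= X -> _]mulrDr.
  by rewrite [_ * (e / _ * _)]mulrA [_ * (e / _)]mulrCA divff ?gt_eqF // mulr1.
have eh : 0 < e * h ^+ 2 by rewrite mulr_gt0 // exprn_gt0.
move: Gl Gr; rewrite /G /g; lra.
Qed.

(** For t outside [0, 1] the chord runs from t to 1, or from 0 to t, with 0 or 1 as its inner point;
    solving for the value at the outer endpoint reverses the inequality. *)
Lemma chord_convex_interp (R : realType) (f : R -> R) (u v : R) :
  chord_convex f -> u = f 1 -> v = f 0 ->
  (forall t : R, t \in `[0, 1]%R -> f t <= t * u + (1 - t) * v) /\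
  (forall t : R, t \notin `[0, 1]%R -> f t >= t * u + (1 - t) * v).
Proof.
move=> convf -> ->; split => t; rewrite in_itv /=.
  by move=> t01; have := convf 0 1 t ltr01 t01; lra.
rewrite negb_and -!ltNge => /orP[t0|t1].
  have := convf t 1 0 (lt_trans t0 ltr01).
  by rewrite (ltW t0) ler01 => /(_ isT); lra.
have := convf 0 t 1 (lt_trans ltr01 t1).
by rewrite (ltW t1) ler01 => /(_ isT); lra.
Qed.

(** * Moduli and phases of complex numbers *)

Section ComplexFacts.
Variable R : realType.
Implicit Types (x y : R) (z : R[i]).

Lemma conj_complexE z : Num.conj z = conjc z. Proof. by []. Qed.

Lemma normc_real x : normc x%:C = `|x|.
Proof. by rewrite /normc /= expr0n addr0 sqrtr_sqr. Qed.

Lemma normc_conj z : normc (Num.conj z) = normc z.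
Proof. by rewrite conj_complexE; case: z => a b; rewrite /normc /= sqrrN. Qed.

Lemma normc_expi x : normc (expi x) = 1.
Proof. by rewrite /normc /expi cos2Dsin2 sqrtr1. Qed.

Lemma expi_mul_conj x y : expi x * Num.conj (expi y) = expi (x - y).
Proof.
by rewrite conj_complexE /expi; simpc; rewrite cosB sinB; congr (_ +i* _); ring.
Qed.

Lemma expiD_expiN x : expi x + expi (- x) = (2 * cos x)%:C.
Proof. by rewrite /expi cosN sinN; simpc; congr (_ +i* _); ring. Qed.

End ComplexFacts.

(** * The generalized numerical radius: seminorm bounds and unitary invariance *)

Section NumRadius.
Variables (R : realType) (n : nat) (N : 'M[R[i]]_n -> R).
Hypotheses (normN : is_mxnorm N) (invN : unitarily_invariant N).
Implicit Types (X Y Z U : 'M[R[i]]_n) (t h theta : R).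

Lemma mxnormZr (x : R) Y : 0 <= x -> N (x%:C *: Y) = x * N Y.
Proof. by move=> x0; rewrite (mxnormZ normN) normc_real ger0_norm. Qed.

Lemma mxnorm_half Y : N (2^-1 *: Y) = 2^-1 * N Y.
Proof. by rewrite -mxnormZr ?invr_ge0 // fmorphV rmorph_nat. Qed.

Lemma mxnorm0 : N 0 = 0.
Proof. by rewrite -(scale0r (0 : 'M_n)) (mxnormZ normN) normc0 mul0r. Qed.

(** Expansion in matrix units; it turns entrywise estimates into norm estimates, both for continuity
    and for the o(h^2) error. *)
Lemma ler_mxnorm_entries Y :
  N Y <= \sum_i \sum_j normc (Y i j) * N (delta_mx i j).
Proof.
have Nsum (F : 'I_n -> 'M_n) : N (\sum_i F i) <= \sum_i N (F i).
  apply: (big_ind2 (fun Z x => N Z <= x)) => //; first by rewrite mxnorm0.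
  by move=> Z x W y Zx Wy; apply: le_trans (ler_mxnormD normN _ _) (lerD _ _).
rewrite {1}[Y]matrix_sum_delta; apply: le_trans (Nsum _) _.
apply: ler_sum => i _; apply: le_trans (Nsum _) _.
by apply: ler_sum => j _; rewrite (mxnormZ normN).
Qed.

Lemma mxReD Y Z : mxRe (Y + Z) = mxRe Y + mxRe Z.
Proof. by apply/matrixP => i j; rewrite !mxE rmorphD /=; ring. Qed.

Lemma mxRe_unitary U Y : mxRe (U *m Y *m U ^t*) = U *m mxRe Y *m U ^t*.
Proof.
rewrite /mxRe; have -> : (U *m Y *m U ^t*) ^t* = U *m Y ^t* *m U ^t*.
  rewrite !trmx_mul !map_mxM /= mulmxA; congr (_ *m _ *m _).
  exact: trmxCK.
by rewrite -scalemxAr -scalemxAl mulmxDr mulmxDl.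
Qed.

(** The right-hand side is independent of [theta], so the supremum defining [num_radius] is over a
    bounded set. *)
Lemma ler_mxnorm_mxRe theta Y :
  N (mxRe (expi theta *: Y)) <= 2^-1 * (N Y + N (Y ^t*)).
Proof.
rewrite /mxRe mxnorm_half ler_pM2l ?invr_gt0 //.
apply: le_trans (ler_mxnormD normN _ _) _.
rewrite linearZ /= map_mxZ !(mxnormZ normN) normc_conj normc_expi.
by rewrite !mul1r.
Qed.

Lemma num_radius_ge theta Y : N (mxRe (expi theta *: Y)) <= num_radius N Y.
Proof.
apply: ub_le_sup; last by exists theta.
by exists (2^-1 * (N Y + N (Y ^t*))) => _ [th _ <-]; exact: ler_mxnorm_mxRe.
Qed.

Lemma num_radius_le Y (c : R) :
  (forall theta, N (mxRe (expi theta *: Y)) <= c) -> num_radius N Y <= c.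
Proof.
move=> Yc; apply: ge_sup; last by move=> _ [th _ <-].
by exists (N (mxRe (expi 0 *: Y))), 0.
Qed.

Lemma num_radiusD Y Z : num_radius N (Y + Z) <= num_radius N Y + num_radius N Z.
Proof.
apply: num_radius_le => th; rewrite scalerDr mxReD.
by apply: le_trans (ler_mxnormD normN _ _) (lerD _ _); exact: num_radius_ge.
Qed.

Lemma num_radius_unitary U Y :
  U \is unitarymx -> num_radius N (U *m Y *m U ^t*) = num_radius N Y.
Proof.
move=> Uu; rewrite /num_radius; congr (sup _).
apply: eq_imagel => th _.
have -> : expi th *: (U *m Y *m U ^t*) = U *m (expi th *: Y) *m U ^t*.
  by rewrite -scalemxAr -scalemxAl.
by rewrite mxRe_unitary; apply: invN; rewrite ?trmxC_unitary.
Qed.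

(** The bound of [ler_mxnorm_mxRe] for a matrix unit, whose adjoint is the transposed unit. *)
Definition delta_radius i j := 2^-1 * (N (delta_mx i j) + N (delta_mx j i)).

Lemma num_radius_entries Y :
  num_radius N Y <= \sum_i \sum_j normc (Y i j) * delta_radius i j.
Proof.
apply: num_radius_le => th; apply: le_trans (ler_mxnorm_mxRe _ _) _.
rewrite /delta_radius.
under eq_bigr do under eq_bigr do rewrite mulrCA mulrDr.
under eq_bigr do rewrite -mulr_sumr big_split /=.
rewrite -mulr_sumr big_split /= ler_pM2l ?invr_gt0 // lerD ?ler_mxnorm_entries //.
(* This sum bounds the norm of the adjoint of Y, whose entries sit at swapped indices. *)
rewrite exchange_big /=; apply: le_trans (ler_mxnorm_entries _) _.
by apply: ler_sum => i _; apply: ler_sum => j _; rewrite !mxE normc_conj.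
Qed.

(** Subadditivity applied to Y = Z + (Y - Z) and with the roles exchanged; this Lipschitz bound
    yields continuity in t. *)
Lemma num_radius_dist Y Z :
  `|num_radius N Y - num_radius N Z| <=
  \sum_i \sum_j normc (Y i j - Z i j) * delta_radius i j.
Proof.
have le1 (V W : 'M[R[i]]_n) : num_radius N V - num_radius N W <=
    \sum_i \sum_j normc (V i j - W i j) * delta_radius i j.
  have := num_radiusD W (V - W); rewrite addrC subrK -lerBlDl => /le_trans; apply.
  apply: le_trans (num_radius_entries _) _.
  by apply: ler_sum => i _; apply: ler_sum => j _; rewrite !mxE.
apply/ler_normlP; split; last exact: le1; rewrite opprB.
apply: le_trans (le1 _ _) _; apply: ler_sum => i _; apply: ler_sum => j _.
by rewrite -opprB normcN.
Qed.

End NumRadius.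

(** * Convexity along the path for diagonal A *)

Section PowPath.
Variables (R : realType) (n : nat) (N : 'M[R[i]]_n -> R).
Hypotheses (normN : is_mxnorm N) (invN : unitarily_invariant N).
Implicit Types (t h theta : R).
Variables (l : 'I_n -> R) (X : 'M[R[i]]_n).

(* [A^t X A^(1-t)] for A diagonal with entries [exp (l i)]. *)
Definition pow_path t : 'M[R[i]]_n :=
  \matrix_(i, j) ((expR (t * l i + (1 - t) * l j))%:C * X i j).

Let f t := num_radius N (pow_path t).

Lemma continuous_pow_path : continuous f.
Proof.
pose E i j s : R := expR (s * l i + (1 - s) * l j).
have cE i j : continuous (E i j).
  move=> s; apply: continuous_comp; last exact: continuous_expR.
  apply: cvgD; apply: cvgM; try exact: cvg_cst; first exact: cvg_id.
  by apply: cvgB; [exact: cvg_cst|exact: cvg_id].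
move=> t.
(* The Lipschitz bound on the distance between f t and f s: continuous in s and zero at s = t. *)
pose g s :=
  \sum_i \sum_j (`|E i j t - E i j s| * (normc (X i j) * delta_radius N i j)).
have gt0 : g s @[s --> t] --> g t.
  apply: cvg_sumr => i; apply: cvg_sumr => j.
  apply: cvgM; last exact: cvg_cst.
  by apply: cvg_norm; apply: cvgB; [exact: cvg_cst|exact: cE].
have g0 : g t = 0.
  by rewrite /g; apply: big1 => i _; apply: big1 => j _; rewrite subrr normr0 mul0r.
rewrite g0 in gt0.
apply/cvgrPdist_le => e e0.
near=> s.
have ge : `|0 - g s| <= e by near: s; exact: (cvgrPdist_le _ _).1 gt0 e e0.
rewrite sub0r normrN in ge.
apply: le_trans (le_trans (ler_norm _) ge).
apply: le_trans (num_radius_dist normN _ _) _.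
apply: ler_sum => i _; apply: ler_sum => j _.
by rewrite !mxE -mulrBl normcM -rmorphB normc_real -mulrA.
Unshelve. all: by end_near. Qed.

(** Independent of theta, so an error bounded through [m] survives the supremum. *)
Let m t i j := 2^-1 * (normc (pow_path t i j) + normc (pow_path t j i)).
Let cc (y : R) := cos y * ((expR y + expR (- y)) / 2) - 1.

Lemma normc_mxRe_pow_path t theta i j :
  normc (mxRe (expi theta *: pow_path t) i j) <= m t i j.
Proof.
rewrite /m [mxRe _ i j]mxE normcM.
rewrite (_ : normc (2^-1 : R[i]) = 2^-1); last first.
  by rewrite -(rmorph_nat (real_complex R)) -fmorphV normc_real ger0_norm ?invr_ge0.
rewrite ler_pM2l ?invr_gt0 //.
move: (pow_path t) => Y; rewrite !mxE.
apply: le_trans (le_normcD _ _) _.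
by rewrite normc_conj !normcM normc_expi !mul1r.
Qed.

(** Real factors commute with conjugation, and transposition swaps u and v. Hence adding P and Q
    gives the entry of S and its conjugate partner the same factor u + v. *)
Lemma mxRe_scale_pair (z : R[i]) (P Q S : 'M[R[i]]_n) (u v : R) i j :
  P i j = u%:C * S i j -> Q i j = v%:C * S i j ->
  P j i = v%:C * S j i -> Q j i = u%:C * S j i ->
  mxRe (z *: P) i j + mxRe (z *: Q) i j = (u + v)%:C * mxRe (z *: S) i j.
Proof.
rewrite !mxE => -> -> -> ->.
have conjR (x : R) (w : R[i]) : Num.conj (z * (x%:C * w)) = x%:C * Num.conj (z * w).
  by rewrite mulrCA rmorphM; congr (_ * _); exact: conjc_real.
rewrite !conjR rmorphD /=; move: (Num.conj _) => c0; ring.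
Qed.

Lemma mxRe_pow_path_cosh t h theta i j :
  mxRe (expi theta *: pow_path (t + h)) i j +
  mxRe (expi theta *: pow_path (t - h)) i j =
  (expR (h * (l i - l j)) + expR (- (h * (l i - l j))))%:C *
  mxRe (expi theta *: pow_path t) i j.
Proof.
have shift s a b : pow_path (t + s) a b =
    (expR (s * (l a - l b)))%:C * pow_path t a b.
  rewrite !mxE mulrA -(rmorphM (real_complex R)) -expRD.
  by congr ((expR _)%:C * _); ring.
apply: mxRe_scale_pair; rewrite shift; congr ((expR _)%:C * _); ring.
Qed.

(** This diagonal matrix of phases is A^(ih) for A = diag(exp(l_i)). *)
Lemma diag_expi_unitary h : diag_mx (\row_i expi (h * l i)) \is unitarymx.
Proof.
apply/unitarymxP/matrixP => i j.
rewrite mul_diag_mx !mxE.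
case: eqVneq => [->|ij]; last by rewrite mulr0n rmorph0 mulr0.
by rewrite mulr1n expi_mul_conj subrr /expi cos0 sin0.
Qed.

Lemma unitary_conj_entry h (K : 'M[R[i]]_n) i j :
  let D := diag_mx (\row_i expi (h * l i)) in
  (D *m K *m D ^t*) i j = expi (h * (l i - l j)) * K i j.
Proof.
move=> D; rewrite /D tr_diag_mx map_diag_mx mul_mx_diag mul_diag_mx !mxE.
by rewrite mulrBr -expi_mul_conj mulrAC.
Qed.

Lemma mxnorm_cos_le h (K : 'M[R[i]]_n) :
  N (\matrix_(i, j) ((cos (h * (l i - l j)))%:C * K i j)) <= N K.
Proof.
pose D s := diag_mx (\row_i expi (s * l i)).
have -> : \matrix_(i, j) ((cos (h * (l i - l j)))%:C * K i j) =
    2^-1 *: (D h *m K *m D h ^t* + D (- h) *m K *m D (- h) ^t*).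
  apply/matrixP => i j; rewrite mxE [RHS]mxE [in RHS]mxE !unitary_conj_entry.
  rewrite mulNr -mulrDl expiD_expiN rmorphM rmorph_nat -mulrA mulKf //.
  by rewrite pnatr_eq0.
rewrite (mxnorm_half normN); apply: le_trans (_ : 2^-1 * (N K + N K) <= _).
  rewrite ler_pM2l ?invr_gt0 //.
  apply: le_trans (ler_mxnormD normN _ _) _.
  by rewrite !invN ?trmxC_unitary ?diag_expi_unitary.
by lra.
Qed.

(** At each theta, H splits as C + W: C is K with its entries multiplied by cosines, a norm
    contraction, and W carries the defect of cos y cosh y from 1, estimated entry by entry. *)
Lemma pow_path_midpoint t h :
  2 * f t <= f (t + h) + f (t - h) +
    2 * \sum_i \sum_j `|cc (h * (l i - l j))| * (m t i j * N (delta_mx i j)).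
Proof.
have half (a b d s : R) : a <= 2^-1 * (b + d) + s -> 2 * a <= b + d + 2 * s.
  by lra.
apply: half.
apply: num_radius_le => th.
set H := mxRe _.
pose K : 'M[R[i]]_n := 2^-1 *:
  (mxRe (expi th *: pow_path (t + h)) + mxRe (expi th *: pow_path (t - h))).
pose C : 'M[R[i]]_n := \matrix_(i, j) ((cos (h * (l i - l j)))%:C * K i j).
pose W : 'M[R[i]]_n := \matrix_(i, j) ((- cc (h * (l i - l j)))%:C * H i j).
have -> : H = C + W.
  apply/matrixP => i j; rewrite [RHS]mxE [C i j]mxE [W i j]mxE [K i j]mxE.
  rewrite [X in 2^-1 * X]mxE mxRe_pow_path_cosh -/H.
  have split2 (x y : R) (z : R[i]) :
      z = x%:C * (2^-1 * (y%:C * z)) + (- (x * (y / 2) - 1))%:C * z.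
    rewrite -(rmorph_nat (real_complex R)) -fmorphV !mulrA -!rmorphM -mulrDl.
    have e1 : x / 2 * y - (x * y / 2 - 1) = 1 by field.
    by rewrite -rmorphD e1 mul1r.
  exact: split2.
apply: le_trans (ler_mxnormD normN _ _) (lerD _ _).
  apply: le_trans (mxnorm_cos_le _ _) _; rewrite /K (mxnorm_half normN).
  rewrite ler_pM2l ?invr_gt0 //.
  by apply: le_trans (ler_mxnormD normN _ _) (lerD _ _); exact: (num_radius_ge normN).
apply: le_trans (ler_mxnorm_entries normN _) _.
apply: ler_sum => i _; apply: ler_sum => j _.
rewrite mxE normcM normc_real normrN -mulrA.
rewrite ler_wpM2l // ler_wpM2r ?(mxnorm_ge0 normN) //.
exact: normc_mxRe_pow_path.
Qed.

Lemma pow_path_approx_midpoint t (e d : R) : 0 < e -> 0 < d ->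
  exists2 h, 0 < h < d & 2 * f t <= f (t + h) + f (t - h) + e * h ^+ 2.
Proof.
move=> e0 d0.
pose g h := 2 * \sum_i \sum_j
  (`|cc (h * (l i - l j)) / h ^+ 2| * (m t i j * N (delta_mx i j))).
(* The limit of g, left unsimplified to match the termwise limit rules; it equals 0. *)
pose L : R := 2 * \sum_i \sum_j (`|0 : R| * (m t i j * N (delta_mx i j))).
have L0 : L = 0.
  rewrite /L big1 ?mulr0 // => i _; rewrite big1 // => j _.
  by rewrite normr0 mul0r.
have g0 : g h @[h --> (0 : R)^'+] --> L.
  apply: cvgM; first exact: cvg_cst.
  apply: cvg_sumr => i; apply: cvg_sumr => j.
  apply: cvgM; last exact: cvg_cst.
  apply: cvg_norm; apply: cvg_dnbhs_at_right.
  exact: cvg_cos_cosh.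
rewrite L0 in g0.
have : \forall h \near (0 : R)^'+, 0 < h < d /\ `|0 - g h| <= e.
  near=> h; split; last by near: h; exact: (cvgrPdist_le _ _).1 g0 e e0.
  by apply/andP; split; near: h; [exact: nbhs_right_gt|exact: nbhs_right_lt].
move=> /filter_ex[h [hd gh]]; exists h => //.
apply: le_trans (pow_path_midpoint t h) _; rewrite lerD2l.
have /andP[h0 _] := hd.
have h2 : 0 < h ^+ 2 by rewrite exprn_gt0.
rewrite -ler_pdivrMr //; apply: le_trans gh; rewrite sub0r normrN.
apply: le_trans (ler_norm _); rewrite /g -mulrA ler_pM2l // mulr_suml.
apply: ler_sum => i _; rewrite mulr_suml; apply: ler_sum => j _.
by rewrite normrM normfV (gtr0_norm h2) mulrAC.
Unshelve. all: by end_near. Qed.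

Lemma pow_path_convex : chord_convex f.
Proof.
exact: (approx_midpoint_convex continuous_pow_path pow_path_approx_midpoint).
Qed.

End PowPath.

(** * Reduction of a positive definite A to diagonal form *)

Section PosDef.
Variables (R : realType) (n : nat) (A : 'M[R[i]]_n).
Hypothesis posA : posdefmx A.

Let P := spectralmx A.
Let d := spectral_diag A.
Let lam i : R := complex.Re (d 0 i).

Lemma posdef_spectralE : A = P ^t* *m diag_mx d *m P.
Proof.
have [hA _] := posA.
have /orthomx_spectralP := hermitian_normalmx hA.
by rewrite invmx_unitary // spectral_unitarymx.
Qed.

(** The eigenvalue is the quadratic form of A at the i-th column of P^*, which is nonzero because P
    P^* has unit diagonal. *)
Lemma posdef_spectral_gt0 i : 0 < d 0 i.
Proof.
have [_ pA] := posA.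
have Pu : P \is unitarymx by exact: spectral_unitarymx.
have PP : P *m P ^t* = 1%:M by apply/unitarymxP.
have row_col (M K : 'M[R[i]]_n) : (row i M *m col i K) 0 0 = (M *m K) i i.
  by rewrite !mxE; apply: eq_bigr => k _; rewrite !mxE.
have tcol : (col i (P ^t*)) ^t* = row i P.
  by apply/matrixP => a b; rewrite !mxE conjCK.
have x0 : col i (P ^t*) != 0.
  apply/eqP => x0; have := row_col P (P ^t*).
  by rewrite x0 mulmx0 PP !mxE eqxx => /esym/eqP; rewrite oner_eq0.
have := pA _ x0; rewrite tcol -row_mul row_col {1}posdef_spectralE.
by rewrite !mulmxA PP mul1mx -mulmxA PP mulmx1 mxE eqxx mulr1n.
Qed.

Lemma posdef_lam_gt0 i : 0 < lam i.
Proof. by have := posdef_spectral_gt0 i; rewrite ltcE => /andP[]. Qed.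

Lemma mxpowRE t :
  mxpowR A t = P ^t* *m diag_mx (\row_i (expR (t * ln (lam i)))%:C) *m P.
Proof.
have Pu : P \is unitarymx by exact: spectral_unitarymx.
rewrite /mxpowR /herm_calc -/P -/d (invmx_unitary Pu).
set D := map_mx _ d; have -> // : D = \row_i (expR (t * ln (lam i)))%:C.
apply/rowP => i; rewrite !mxE.
(* [powR] treats base 0 separately; positivity of the eigenvalue selects the exponential branch. *)
by rewrite /powR gt_eqF //; exact: posdef_lam_gt0.
Qed.

Lemma mxpowR0 : mxpowR A 0 = 1%:M.
Proof.
rewrite mxpowRE (_ : diag_mx _ = 1%:M).
  rewrite mulmx1; have := spectral_unitarymx A; rewrite -trmxC_unitary.
  by move/unitarymxP; rewrite trmxCK.
rewrite -diag_const_mx; congr diag_mx; apply/rowP => i.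
by rewrite !mxE mul0r expR0.
Qed.

Lemma mxpowR1 : mxpowR A 1 = A.
Proof.
rewrite mxpowRE; set D := \row_i _.
suff -> : D = d by exact/esym/posdef_spectralE.
apply/rowP => i; rewrite mxE mul1r lnK ?posrE ?posdef_lam_gt0 //.
by rewrite RRe_real // gtr0_real // posdef_spectral_gt0.
Qed.

(** Conjugation by the unitary P turns both powers of A into diagonal exponentials and X into P X
    P^*, without changing the numerical radius. *)
Lemma mxpowR_pow_path (N : 'M[R[i]]_n -> R) (X : 'M[R[i]]_n) t :
  unitarily_invariant N ->
  num_radius N (mxpowR A t *m X *m mxpowR A (1 - t)) =
  num_radius N (pow_path (fun i => ln (lam i)) (P *m X *m P ^t*) t).
Proof.
move=> invN.
have Pu : P ^t* \is unitarymx by rewrite trmxC_unitary spectral_unitarymx.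
rewrite -[RHS](num_radius_unitary invN _ Pu) trmxCK !mxpowRE.
congr num_radius.
set Dt := diag_mx _; set Ds := diag_mx _.
have -> : pow_path (fun i => ln (lam i)) (P *m X *m P ^t*) t =
    Dt *m (P *m X *m P ^t*) *m Ds.
  move: (P *m X *m P ^t*) => Y.
  apply/matrixP => i j; rewrite mul_mx_diag mul_diag_mx !mxE.
  by rewrite expRD rmorphM /= mulrAC.
by rewrite !mulmxA.
Qed.

Lemma num_radius_mxpowR_convex (N : 'M[R[i]]_n -> R) (X : 'M[R[i]]_n) :
  is_mxnorm N -> unitarily_invariant N ->
  chord_convex (fun t => num_radius N (mxpowR A t *m X *m mxpowR A (1 - t))).
Proof.
move=> normN invN.
rewrite (funext (fun t => mxpowR_pow_path X t invN)).
exact: pow_path_convex.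
Qed.

End PosDef.

Local Close Scope classical_set_scope.

Theorem mainTheorem5 (R : realType) (n : nat) (N : 'M[R[i]]_n -> R)
    (normN : is_mxnorm N) (invN : unitarily_invariant N)
    (A X : 'M[R[i]]_n) (posA : posdefmx A) :
  (forall t : R, t \in `[0, 1] ->
     num_radius N (mxpowR A t *m X *m mxpowR A (1 - t))
       <= t * num_radius N (A *m X) + (1 - t) * num_radius N (X *m A)) /\
  (forall t : R, t \notin `[0, 1] ->
     num_radius N (mxpowR A t *m X *m mxpowR A (1 - t))
       >= t * num_radius N (A *m X) + (1 - t) * num_radius N (X *m A)).
Proof.
move: (mxpowR0 posA) (mxpowR1 posA) (num_radius_mxpowR_convex posA X normN invN).
(* Only convexity and the values A^0 = 1 and A^1 = A matter from here on, so the power function is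
   generalized. *)
move: (mxpowR A) => B B0 B1.
set f := fun t => _; move=> convf.
have f1 : num_radius N (A *m X) = f 1 by rewrite /f subrr B1 B0 mulmx1.
have f0 : num_radius N (X *m A) = f 0.
  by clear f1; rewrite /f subr0 B0 mul1mx B1.
exact: chord_convex_interp convf f1 f0.
Qed.
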